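(* Let $G$ and $H$ be two graphs that are cospectral with respect to the adjacency matrix and such that $b(G)\neq b(H)$, where $b$ denotes the burning number. Then there exist infinitely many pairs of graphs that are cospectral with respect to the adjacency matrix and have different burning numbers.
   Context: All graphs are finite, undirected and simple. ''Infinitely many pairs'' is understood up to isomorphism. The spectrum of a graph is the multiset of eigenvalues of its adjacency matrix; two graphs are cospectral (with respect to the adjacency matrix) if they have the same spectrum. Burning process on a graph $G$: at round $t=0$ all vertices are unburned. In each round $t\geq 1$, first an unburned vertex (if there is one) is chosen to become burned; it is called the source of round $t$. Then, in the same round, all neighbors of vertices that were burned by the end of round $t-1$ become burned. Burned vertices remain burned. The process ends when all vertices are burned. The burning number $b(G)$ is the minimum number of rounds needed to burn all vertices of $G$. *)

(* Defs.v *)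
(* Built on MathComp. *)
From mathcomp Require Import all_boot all_algebra all_field.

Set Implicit Arguments.
Unset Strict Implicit.
Unset Printing Implicit Defensive.

Import GRing.Theory.
Local Open Scope ring_scope.

Record sgraph := SGraph {
  vertex :> finType;
  adj : rel vertex;
  adj_sym : symmetric adj;
  adj_irrefl : irreflexive adj
}.

Definition isomorphic (G H : sgraph) : Prop :=
  exists2 f : G -> H, bijective f & forall x y : G, adj (f x) (f y) = adj x y.

(* Pairs of graphs are unordered. *)
Definition pair_isomorphic (P Q : sgraph * sgraph) : Prop :=
  (isomorphic P.1 Q.1 /\ isomorphic P.2 Q.2) \/
  (isomorphic P.1 Q.2 /\ isomorphic P.2 Q.1).

Section Spectrum.

Variable G : sgraph.

Definition adjmx : 'M[algC]_#|G| :=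
  \matrix_(i, j) (adj (enum_val i) (enum_val j))%:R.

(* The roots of the characteristic polynomial, listed with multiplicity in an
   arbitrary order. Eigenvalues of an integer matrix are algebraic, so no
   eigenvalue is lost by working over algC. *)
Definition spectrum : seq algC :=
  sval (closed_field_poly_normal (char_poly adjmx)).

Lemma char_poly_spectrum :
  char_poly adjmx = \prod_(a <- spectrum) ('X - a%:P).
Proof.
rewrite /spectrum; case: closed_field_poly_normal => r /= {1}->.
by rewrite (monicP (char_poly_monic _)) scale1r.
Qed.

Lemma mem_spectrum a : (a \in spectrum) = eigenvalue adjmx a.
Proof. by rewrite eigenvalue_root_char char_poly_spectrum root_prod_XsubC. Qed.

Lemma size_spectrum : size spectrum = #|G|.
Proof.
apply: succn_inj.
by rewrite -(size_char_poly adjmx) char_poly_spectrum size_prod_XsubC.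
Qed.

End Spectrum.

Definition cospectral (G H : sgraph) : Prop :=
  perm_eq (spectrum G) (spectrum H).

Section Burning.

Variable G : sgraph.
Implicit Types (B : {set G}) (v : G) (s : seq G).

(* The burned set after a round with source [v], when [B] is the burned set at
   the end of the previous round. The fire spreads from [B] only, not from
   [v]. *)
Definition burn_round B v : {set G} :=
  v |: (B :|: [set y | [exists x in B, adj x y]]).

(* [burns B s]: starting with [B] burned, a run of the process with successive
   sources [s] (one per round) is legal and ends with every vertex burned.
   Since the process stops once all vertices are burned, every round has an
   unburned vertex available as a source. *)
Fixpoint burns B s : bool :=
  if s is v :: s' then (v \notin B) && burns (burn_round B v) s'
  else B == [set: G].

Definition burnable (n : nat) : bool :=
  [exists s : n.-tuple G, burns set0 s].

Lemma burns_exists B : exists s, burns B s.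
Proof.
have [n] := ubnP #|~: B|; elim: n B => // n IHn B leBn.
have [BT|] := boolP (B == [set: G]); first by exists [::].
rewrite eqEsubset subsetT => /subsetPn[v _ vB].
have [|s bs] := IHn (burn_round B v); last by exists (v :: s); rewrite /= vB.
rewrite -ltnS; apply: leq_trans leBn; rewrite ltnS; apply: proper_card.
apply/properP; split; first by rewrite setCS /burn_round setUCA subsetUl.
by exists v; rewrite !inE ?vB ?eqxx.
Qed.

Lemma burnable_exists : exists n, burnable n.
Proof.
have [s bs] := burns_exists set0.
by exists (size s); apply/existsP; exists (in_tuple s).
Qed.

Definition burning_number : nat := ex_minn burnable_exists.

End Burning.

(* Main.v *)
Require Import Defs.
From mathcomp Require Import all_boot.
From mathcomp Require Import all_fingroup all_algebra all_field zify.

(** Let [b = b(G) < b(H)] and let [X] be a graph with burning number greater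
    than [b] that contains a vertex at distance at most [b] from all others.
    Starting in [X] and then burning [G] takes [b + 1] rounds on the disjoint
    union [G + X].  In a run of [b + 1] rounds on [H + X], one of the two
    components misses the first source, and [b] rounds are not enough for it.
    So [G + X] and [H + X] are still separated, and they are cospectral because
    the characteristic polynomial is multiplicative on disjoint unions.
    Arbitrarily large such [X] are obtained by joining the ends of many paths
    with [b] vertices into a clique. *)

Set Implicit Arguments.
Unset Strict Implicit.
Unset Printing Implicit Defensive.

Import GRing.Theory.

(** * Burning with idle or repeated sources *)

(* Rounds may have no source or an already burned one: unlike [burns], this
   relaxation restricts to the components of a disjoint union. *)
Definition free_round (G : sgraph) (B : {set G}) (o : option G) : {set G} :=
  [set y | [|| o == Some y, y \in B | [exists x in B, adj x y]]].

Definition free_burn (G : sgraph) : {set G} -> seq (option G) -> {set G} :=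
  foldl (@free_round G).

Lemma free_round_some (G : sgraph) (B : {set G}) v :
  free_round B (Some v) = burn_round B v.
Proof. by apply/setP => y; rewrite !inE (inj_eq Some_inj) eq_sym. Qed.

Lemma free_round_set0 (G : sgraph) : free_round set0 None = set0 :> {set G}.
Proof.
by apply/setP => y; rewrite !inE /=; apply/existsP => -[x]; rewrite inE.
Qed.

Lemma sub_free_round (G : sgraph) (B : {set G}) o : B \subset free_round B o.
Proof. by apply/subsetP => y yB; rewrite inE yB orbT. Qed.

Lemma sub_free_burn (G : sgraph) (B : {set G}) s : B \subset free_burn B s.
Proof.
elim: s B => [|o s IHs] B //=.
exact: subset_trans (sub_free_round B o) (IHs _).
Qed.

Lemma free_round_mono (G : sgraph) (B B' : {set G}) o :
  B \subset B' -> free_round B o \subset free_round B' o.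
Proof.
move=> sBB'; apply/subsetP => y; rewrite !inE => /or3P[-> // | /(subsetP sBB') -> |].
  by rewrite orbT.
case/existsP=> x /andP[xB xy]; apply/or3P/Or33/existsP.
by exists x; rewrite (subsetP sBB').
Qed.

(** Serves to simulate relaxed rounds by legal ones: a source already burned in [B'] is wasted, so
    any [v] may stand in for it. *)
Lemma free_round_burn_round (G : sgraph) (B B' : {set G}) o v :
    B \subset B' -> (if o is Some w then (w \in B') || (w == v) else true) ->
  free_round B o \subset burn_round B' v.
Proof.
move=> sBB' ov; rewrite -free_round_some.
apply: subset_trans (free_round_mono o sBB') _.
apply/subsetP => y; rewrite !inE => /or3P[/eqP oy | -> | ->]; last 2 first.
- by rewrite orbT.
- by rewrite !orbT.
by move: ov; rewrite oy => /orP[-> | /eqP->]; rewrite ?eqxx ?orbT.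
Qed.

Lemma burns_free_burn (G : sgraph) (B : {set G}) s :
  burns B s -> free_burn B (map Some s) = [set: G].
Proof.
elim: s B => [|v s IHs] B /=; first by move/eqP.
by case/andP=> _ /IHs; rewrite -free_round_some.
Qed.

(** A legal run can be kept ahead of the relaxed one; it may finish early, hence the inequality on
    sizes. *)
Lemma free_burn_burns (G : sgraph) (B B' : {set G}) s :
    free_burn B s = [set: G] -> B \subset B' ->
  exists2 s', size s' <= size s & burns B' s'.
Proof.
elim: s B B' => [|o s IHs] B B' /= BT sBB'.
  by exists [::] => //=; rewrite -subTset -BT.
have [B'T | ] := boolP (B' == setT); first by exists [::].
rewrite -subTset => /subsetPn[w _ wB'].
(* Keep the relaxed source if it is unburned in [B']; otherwise play the unburned [w]. *)
pose v := if o is Some u then if u \in B' then w else u else w.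
have vB' : v \notin B' by rewrite /v; case: (o) => // u; case: ifPn.
have sB : free_round B o \subset burn_round B' v.
  apply: free_round_burn_round sBB' _; rewrite /v; case: (o) => // u.
  by case: ifP => //=; rewrite eqxx.
have [s' les' bs'] := IHs _ _ BT sB.
by exists (v :: s'); rewrite //= vB'.
Qed.

(** Padding with [None] gives exactly [n] rounds, since idle rounds never lose burned vertices. *)
Lemma burning_number_leP (G : sgraph) n :
  burning_number G <= n <->
  exists2 s : seq (option G), size s = n & free_burn set0 s = setT.
Proof.
rewrite /burning_number; case: ex_minnP => m /existsP[s bs] minm; split.
  move=> lemn; exists (map Some s ++ nseq (n - m) None).
    by rewrite size_cat size_map size_tuple size_nseq subnKC.
  apply/eqP; rewrite -subTset -(burns_free_burn bs) /free_burn foldl_cat.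
  exact: sub_free_burn.
case=> t <- /free_burn_burns/(_ (subxx _))[s' les' bs'].
apply: leq_trans les'; apply: minm; apply/existsP.
by exists (in_tuple s').
Qed.

(** * Burning disjoint unions *)

Definition disjoint_adj (G H : sgraph) (x y : G + H) : bool :=
  match x, y with
  | inl a, inl b | inr a, inr b => adj a b
  | _, _ => false
  end.

Lemma disjoint_adj_sym (G H : sgraph) : symmetric (@disjoint_adj G H).
Proof. by case=> a [] b //=; rewrite adj_sym. Qed.

Lemma disjoint_adj_irrefl (G H : sgraph) : irreflexive (@disjoint_adj G H).
Proof. by case=> a /=; rewrite adj_irrefl. Qed.

Definition disjoint_union (G H : sgraph) : sgraph :=
  SGraph (@disjoint_adj_sym G H) (@disjoint_adj_irrefl G H).

(** Here [f] embeds [G] as a union of components of [K], with partial inverse [p]. The last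
    hypothesis on [adj] keeps fire from entering the image from outside. *)
Lemma free_burn_preimset (G K : sgraph) (f : G -> K) (p : K -> option G) :
    ocancel p f -> pcancel f p ->
    (forall x y, adj (f x) (f y) = adj x y) ->
    (forall z x, adj z (f x) -> p z) ->
  forall (B : {set K}) s,
    f @^-1: free_burn B s = free_burn (f @^-1: B) (map (obind p) s).
Proof.
move=> pK fK fadj fcl B s; elim: s B => [|o s IHs] B //=.
rewrite IHs; congr (free_burn _ _); apply/setP => y; rewrite !inE; congr [|| _, _ | _].
  case: o => //= z; rewrite (inj_eq Some_inj).
  apply/eqP/eqP => [-> // | pz].
  by have := pK z; rewrite pz.
apply/existsP/existsP => -[z /andP[zB zy]].
  have := pK z; case: (p z) (fcl _ _ zy) => //= x _ xz.
  by exists x; rewrite inE xz zB -fadj xz zy.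
by exists (f z); rewrite inE in zB; rewrite zB fadj.
Qed.

Definition left_part (G H : sgraph) (x : disjoint_union G H) : option G :=
  if x is inl a then Some a else None.

Definition right_part (G H : sgraph) (x : disjoint_union G H) : option H :=
  if x is inr a then Some a else None.

Lemma free_burn_union (G H : sgraph) (s : seq (option (disjoint_union G H))) :
  (free_burn set0 s = setT) <->
  free_burn set0 (map (obind (@left_part G H)) s) = setT /\
  free_burn set0 (map (obind (@right_part G H)) s) = setT.
Proof.
have El : inl @^-1: free_burn set0 s =
    free_burn set0 (map (obind (@left_part G H)) s).
  rewrite (@free_burn_preimset _ (disjoint_union G H) inl (@left_part G H)) //.
  - by rewrite preimset0.
  - by case.
  - by case.
have Er : inr @^-1: free_burn set0 s =
    free_burn set0 (map (obind (@right_part G H)) s).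
  rewrite (@free_burn_preimset _ (disjoint_union G H) inr (@right_part G H)) //.
  - by rewrite preimset0.
  - by case.
  - by case.
rewrite -El -Er; split=> [-> | [lT rT]]; first by rewrite !preimsetT.
apply/setP => -[a|a]; rewrite inE.
  by have := in_setT a; rewrite -lT inE.
by have := in_setT a; rewrite -rT inE.
Qed.

Lemma burning_number_union_le (G X : sgraph) (c : X) b :
    burning_number G <= b ->
    free_burn set0 (Some c :: nseq b None) = setT ->
  burning_number (disjoint_union G X) <= b.+1.
Proof.
move=> /burning_number_leP[s sizes sT] cT; apply/burning_number_leP.
(* [G] idles on [set0] in the first round and then follows [s]; [X] receives only the source [c]. *)
exists (Some (inr c) :: map (omap inl) s); first by rewrite /= size_map sizes.
apply/free_burn_union; split; rewrite /= -map_comp.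
  rewrite free_round_set0 -sT; congr (free_burn _ _).
  by rewrite -[RHS]map_id; apply: eq_map; case.
rewrite -cT /=; congr (free_burn _ _); rewrite -sizes.
by elim: (s) => //= o t ->; case: o.
Qed.

Lemma burning_number_union_gt (H X : sgraph) b :
    b < burning_number H -> b < burning_number X ->
  b.+1 < burning_number (disjoint_union H X).
Proof.
rewrite !ltnNge => bH bX; apply/negP => /burning_number_leP[[|o s] // /succn_inj sizes].
(* A component without the first source is still at [set0] after that round, so the [b] rounds of
   [s] would have to burn it alone. *)
case/free_burn_union; case: o => [[a|a]|] /=; rewrite ?free_round_set0 => lT rT.
- case/negP: bX; apply/burning_number_leP.
  by exists (map (obind (@right_part H X)) s); rewrite ?size_map.
- case/negP: bH; apply/burning_number_leP.
  by exists (map (obind (@left_part H X)) s); rewrite ?size_map.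
- case/negP: bH; apply/burning_number_leP.
  by exists (map (obind (@left_part H X)) s); rewrite ?size_map.
Qed.

(** * Cliques with paths attached *)

(* The vertex [(i, d)] lies on the [i]-th path at distance [d] from the clique
   formed by the ends [(i, 0)]. *)
Definition legs_adj L r (x y : 'I_L * 'I_r) : bool :=
  if x.1 == y.1 then (x.2.+1 == y.2 :> nat) || (y.2.+1 == x.2 :> nat)
  else (x.2 == 0 :> nat) && (y.2 == 0 :> nat).

Lemma legs_adj_sym L r : symmetric (@legs_adj L r).
Proof. by move=> x y; rewrite /legs_adj eq_sym orbC andbC. Qed.

Lemma legs_adj_irrefl L r : irreflexive (@legs_adj L r).
Proof. by move=> x; rewrite /legs_adj eqxx orbb; lia. Qed.

Definition legs L r : sgraph :=
  SGraph (@legs_adj_sym L r) (@legs_adj_irrefl L r).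

(** Each idle round gains one level of depth. The hypothesis on [(ord0, ord0)] serves [k = 0], where
    fire crosses the clique from that vertex; deeper levels catch fire along their own leg. *)
Lemma legs_free_burn L r (B : {set legs L.+1 r.+1}) k m :
    (ord0, ord0) \in B -> (forall x : legs L.+1 r.+1, x.2 < k -> x \in B) ->
  forall x : legs L.+1 r.+1, x.2 < k + m -> x \in free_burn B (nseq m None).
Proof.
elim: m B k => [|m IHm] B k B0 Bk x /=; first by rewrite addn0 => /Bk.
rewrite addnS -addSn => ltx; apply: IHm ltx.
  exact: subsetP (sub_free_round _ _) _ B0.
case=> i d /= led; rewrite inE /=; have [ltd|] := ltnP d k; first by rewrite Bk.
move=> ged; have {led ged} dk : d = k :> nat by lia.
have [k0 | kgt0] := posnP k.
  have [i0 | ni0] := eqVneq ord0 i.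
    suff -> : (i, d) = (ord0, ord0) by rewrite B0.
    by rewrite -i0; congr (_, _); apply/val_inj; rewrite /= dk.
  apply/orP; right; apply/existsP; exists (ord0, ord0).
  by rewrite B0 /= /legs_adj /= (negPf ni0) dk k0.
have ltd : d.-1 < r.+1 by rewrite (leq_ltn_trans (leq_pred _)).
apply/orP; right; apply/existsP; exists (i, Ordinal ltd).
by rewrite Bk /= ?/legs_adj /= ?eqxx dk prednK // eqxx.
Qed.

Lemma legs_center (L r : nat) :
  free_burn set0 (Some ((ord0, ord0) : legs L.+1 r.+1) :: nseq r.+1 None) = setT.
Proof.
apply/setP => x; rewrite in_setT.
by apply: (@legs_free_burn _ _ _ 0 r.+1); rewrite ?inE ?eqxx.
Qed.

(* Fire enters a leg without sources only through its end in the clique. *)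
Lemma legs_slow L r (j : 'I_L) (s : seq (option (legs L r))) (B : {set legs L r}) k :
    (forall x, Some x \in s -> x.1 != j) ->
    (forall x : legs L r, x \in B -> x.1 = j -> x.2 < k) ->
  forall x, x \in free_burn B s -> x.1 = j -> x.2 < k + size s.
Proof.
elim: s B k => [|o s IHs] B k /= sj Bk x; first by rewrite addn0; apply: Bk.
rewrite addnS -addSn; apply: IHs => [y ys | y].
  by apply: sj; rewrite inE ys orbT.
rewrite inE => /or3P[/eqP oy yj | /Bk lty /lty/ltnW // | ].
  by have := sj y; rewrite oy mem_head yj eqxx => /(_ isT).
case/existsP=> z /andP[zB]; rewrite /= /legs_adj; case: eqP => [zy | _].
  by move=> zy2 yj; have := Bk z zB (etrans zy yj); lia.
by case/andP=> _ /eqP->.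
Qed.

(** In [r.+1] rounds, fewer than [L] sources are placed, so some leg has none, and fire cannot reach
    its far end in time. *)
Lemma burning_number_legs L r : r.+1 < L -> r.+1 < burning_number (legs L r.+1).
Proof.
move=> ltrL; rewrite ltnNge; apply/negP => /burning_number_leP[[|o s] // [sizes] sT].
pose t := pmap (omap fst) (o :: s).
have /existsP[j jt] : [exists j, j \notin t].
  rewrite -negb_forall; apply: contraL ltrL => /forallP allt; rewrite -leqNgt.
  have : #|'I_L| <= size t.
    by apply: leq_trans (card_size t); apply/subset_leq_card/subsetP => j.
  move/leq_trans; rewrite card_ord; apply.
  by rewrite size_pmap (leq_trans (count_size _ _)) //= sizes.
have sj x : Some x \in o :: s -> x.1 != j.
  by move=> xs; apply: contraNneq jt => <-; rewrite mem_pmap (map_f (omap fst) xs).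
have := in_setT ((j, ord_max) : legs L r.+1); rewrite -sT => jB.
(* The first round burns nothing in leg [j], hence the bound 0. The [r] rounds left reach only
   depths below [r], while [ord_max] has depth [r]. *)
have := @legs_slow _ _ j s (free_round set0 o) 0 _ _ _ jB erefl.
rewrite add0n sizes ltnn => slow; apply: notF; apply: slow.
  by move=> x xs; apply: sj; rewrite inE xs orbT.
move=> x; rewrite inE => /or3P[/eqP ox xj | | ].
- by have := sj x; rewrite ox mem_head xj eqxx => /(_ isT).
- by rewrite inE.
- by case/existsP=> y; rewrite inE.
Qed.

(** * Characteristic polynomial of a disjoint union *)

Section CharPoly.

Local Open Scope ring_scope.

(** Changing the enumeration permutes rows and columns alike, so the two signs cancel. *)
Lemma det_reindex (R : comNzRingType) (T : finType) n (F : T -> T -> R)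
    (f : 'I_n -> T) :
  bijective f ->
  \det (\matrix_(i < n, j < n) F (f i) (f j)) =
  \det (\matrix_(i < #|T|, j < #|T|) F (enum_val i) (enum_val j)).
Proof.
move=> bij_f; have n_T : n = #|T| by rewrite -(bij_eq_card bij_f) card_ord.
subst n.
have inj_h : injective (enum_rank \o f).
  exact: inj_comp enum_rank_inj (bij_inj bij_f).
set M := (\matrix_(i, j) F (enum_val i) _).
have -> : \matrix_(i, j) F (f i) (f j) =
    row_perm (perm inj_h) (col_perm (perm inj_h) M).
  by apply/matrixP => i j; rewrite !mxE !permE /= !enum_rankK.
rewrite row_permE col_permE !det_mulmx !det_perm odd_permV.
by rewrite mulrC -mulrA -signr_addb addbb mulr1.
Qed.

(** Listing [G] before [H], as [f] does below, makes the characteristic matrix block diagonal. *)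
Lemma char_poly_adjmx_union (G H : sgraph) :
  char_poly (adjmx (disjoint_union G H)) =
  char_poly (adjmx G) * char_poly (adjmx H).
Proof.
pose F (K : sgraph) (x y : K) : {poly algC} := 'X *+ (x == y) - ((adj x y)%:R)%:P.
have cpE (K : sgraph) : char_poly_mx (adjmx K) =
    \matrix_(i, j) F K (enum_val i) (enum_val j).
  by apply/matrixP => i j; rewrite !mxE /F (inj_eq enum_val_inj).
pose f (i : 'I_(#|G| + #|H|)) : disjoint_union G H :=
  match split i with inl a => inl (enum_val a) | inr a => inr (enum_val a) end.
have bij_f : bijective f.
  exists (fun x : G + H => unsplit
    (match x with inl a => inl (enum_rank a) | inr a => inr (enum_rank a) end)).
    by move=> i; rewrite /f -{2}[i]splitK; case: split => a; rewrite enum_valK.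
  by case=> a; rewrite /f unsplitK enum_rankK.
rewrite /char_poly cpE -(det_reindex _ bij_f) !cpE -(det_ublock _ 0).
congr (\det _); apply/matrixP => i j; rewrite !mxE /f.
by case: split => a; rewrite !mxE; case: split => b;
   rewrite !mxE // /F /= polyC0; apply: subrr.
Qed.

Lemma cospectral_char_poly (G H : sgraph) :
  cospectral G H <-> char_poly (adjmx G) = char_poly (adjmx H).
Proof.
rewrite /cospectral !char_poly_spectrum; split; first exact: perm_big.
by move=> eqGH; apply: prod_XsubC_eq.
Qed.

Lemma cospectral_union (G H X : sgraph) :
  cospectral G H -> cospectral (disjoint_union G X) (disjoint_union H X).
Proof.
by rewrite !cospectral_char_poly !char_poly_adjmx_union => ->.
Qed.

End CharPoly.

(** * Vertex counts and the infinite family *)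

Lemma cospectral_card (G H : sgraph) : cospectral G H -> #|G| = #|H|.
Proof. by rewrite -!size_spectrum => /perm_size. Qed.

(** Excludes [burning_number G = 0] in the theorem: [H] has as many vertices as [G], so it would be
    empty too. *)
Lemma burning_number_eq0 (G : sgraph) : (burning_number G == 0) = (#|G| == 0).
Proof.
rewrite -leqn0 -cardsT cards_eq0 eq_sym.
apply/idP/eqP => [/burning_number_leP[s /size0nil->] // | GT].
by apply/burning_number_leP; exists [::].
Qed.

Lemma isomorphic_card (G H : sgraph) : isomorphic G H -> #|G| = #|H|.
Proof. by case=> f bij_f _; apply: bij_eq_card bij_f. Qed.

Theorem corollary4p6 (G H : sgraph)
  (cospGH : cospectral G H) (neqGH : burning_number G <> burning_number H) :
  exists P : nat -> sgraph * sgraph,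
    (forall k : nat, cospectral (P k).1 (P k).2
       /\ burning_number (P k).1 <> burning_number (P k).2)
    /\ (forall i j : nat, i <> j -> ~ pair_isomorphic (P i) (P j)).
Proof.
have eqcard := cospectral_card cospGH.
wlog ltGH : G H cospGH neqGH eqcard / burning_number G < burning_number H.
  move=> gen; have [/gen | /gen | //] := ltngtP (burning_number G) (burning_number H).
    exact.
  by apply=> //; [rewrite /cospectral perm_sym | apply/nesym].
case defb: (burning_number G) => [|r].
  have /eqP := defb; rewrite burning_number_eq0 eqcard -burning_number_eq0.
  by rewrite -leqn0 leqNgt (leq_ltn_trans _ ltGH).
(* Legs have [r.+1 = burning_number G] vertices, and [r.+2] of them already outnumber the sources of
   [r.+1] rounds; [k] only adds legs. *)
pose X k := legs (k + r.+2) r.+1.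
exists (fun k => (disjoint_union G (X k), disjoint_union H (X k))).
split=> [k | i j neqij] /=.
  split; first exact: cospectral_union.
  have leG : burning_number (disjoint_union G (X k)) <= r.+2.
    rewrite /X addnS; apply: burning_number_union_le (legs_center _ _).
    by rewrite defb.
  have gtH : r.+2 < burning_number (disjoint_union H (X k)).
    apply: burning_number_union_gt; first by rewrite -defb.
    by apply: burning_number_legs; lia.
  by apply/eqP; rewrite ltn_eqF // (leq_ltn_trans leG).
have cardX k : #|X k| = (k + r.+2) * r.+1 by rewrite card_prod !card_ord.
have inj_cardX : #|X i| <> #|X j|.
  by rewrite !cardX => /eqP; rewrite eqn_pmul2r // eqn_add2r => /eqP.
(* Since [G] and [H] have equal order, either matching of the pairs forces [X i] and [X j] to have
   equal order. *)
by case=> -[/isomorphic_card + _] /=; rewrite !card_sum -?eqcard => /addnI.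
Qed.
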